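(* Let $\mathscr{T}$ be a triangulated category, let $\mathscr{B}$ be a small full subcategory of $\mathscr{T}$ closed under the translation functor $\Sigma$, and let $\mathscr{C}$ be the thick full subcategory of $\mathscr{T}$ generated by $\mathscr{B}$. Suppose that for every exact triangle $$K\to L\to M\to\Sigma K$$ in $\mathscr{T}$ with $K,L,M\in\mathscr{C}$ and every $X\in\mathscr{C}$, the induced long sequence of abelian groups $$\cdots\to\mathbb{P}\mathbb{F}X(\Sigma K)\to\mathbb{P}\mathbb{F}X(M)\to\mathbb{P}\mathbb{F}X(L)\to\mathbb{P}\mathbb{F}X(K)\to\cdots$$ is exact. Then $\varepsilon\colon\mathbb{P}\mathbb{F}X\to\mathbb{Y}X$ is an isomorphism for every $X\in\mathscr{C}$, and the Freyd conjecture holds for $(\mathscr{C},\mathscr{B})$.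
   Context: Write $[X,Y]$ for the abelian group of maps $X\to Y$ in $\mathscr{T}$; also $\mathscr{B}(X,Y)=[X,Y]$ for $X,Y\in\mathscr{B}$ and $\mathscr{C}(X,Y)=[X,Y]$ for $X,Y\in\mathscr{C}$. The thick full subcategory $\mathscr{C}$ generated by $\mathscr{B}$ is the smallest full subcategory of $\mathscr{T}$ that contains $\mathscr{B}$, is closed under retracts, and has the property that if two terms of an exact triangle are in $\mathscr{C}$ then so is the third. $\mathscr{P}\mathscr{B}$ (resp. $\mathscr{P}\mathscr{C}$) is the category of additive functors $\mathscr{B}^{op}\to \mathrm{Ab}$ (resp. $\mathscr{C}^{op}\to\mathrm{Ab}$) and additive natural transformations. The Freyd functor $\mathbb{F}\colon\mathscr{T}\to\mathscr{P}\mathscr{B}$ sends $X$ to $\mathbb{F}X(-)=[-,X]$ and $f\colon X\to Y$ to $f_*=[-,f]$. The functor $\mathbb{Y}\colon\mathscr{T}\to\mathscr{P}\mathscr{C}$ is defined in the same way, $\mathbb{Y}X(-)=[-,X]$; restricted to $\mathscr{C}$ it is the Yoneda embedding. The Freyd conjecture is said to hold for the pair $(\mathscr{C},\mathscr{B})$ if the restriction $\mathbb{F}\colon\mathscr{C}\to\mathscr{P}\mathscr{B}$ is faithful, i.e. for every map $f$ in $\mathscr{C}$, $\mathbb{F}f=0$ if and only if $f=0$. $\mathbb{U}\colon\mathscr{P}\mathscr{C}\to\mathscr{P}\mathscr{B}$ is restriction of presheaves along the inclusion $\mathscr{B}\to\mathscr{C}$, so $\mathbb{F}=\mathbb{U}\mathbb{Y}$.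 $\mathbb{P}\colon\mathscr{P}\mathscr{B}\to\mathscr{P}\mathscr{C}$ is its left adjoint, given for $T\in\mathscr{P}\mathscr{B}$, $K\in\mathscr{C}$ by the categorical tensor product $\mathbb{P}T(K)=T\otimes_{\mathscr{B}}\mathscr{C}(K,-)$, that is, the coequalizer in $\mathrm{Ab}$ of the two maps $\bigoplus_{I,J\in\mathscr{B}}T(J)\otimes\mathscr{B}(I,J)\otimes\mathscr{C}(K,I)\rightrightarrows\bigoplus_{J\in\mathscr{B}}T(J)\otimes\mathscr{C}(K,J)$ given by the action of $\mathscr{B}$ on $T$ and by composition in $\mathscr{C}$. The natural transformation $\varepsilon\colon\mathbb{P}\mathbb{U}\to\mathrm{Id}$ is the counit of the adjunction $(\mathbb{P},\mathbb{U})$; its component at $\mathbb{Y}X$ is a map $\varepsilon\colon\mathbb{P}\mathbb{F}X=\mathbb{P}\mathbb{U}\mathbb{Y}X\to\mathbb{Y}X$. The long sequence in the claim is obtained by applying the contravariant functor $\mathbb{P}\mathbb{F}X$ to the doubly infinite sequence of maps $\cdots\to\Sigma^{-1}M\to K\to L\to M\to\Sigma K\to\Sigma L\to\cdots$ generated by the triangle.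
   Formalization: B is assumed closed, up to isomorphism, under both Σ and its inverse; with closure under Σ alone the claim fails, e.g. for the bounded derived category of a field k and B = {k[n] : n ≥ 0}, where F(k[-1]) = 0. *)

(* Defs.v *)
From HB Require Import structures.
From mathcomp Require Import all_boot all_order all_algebra.
From mathcomp Require Import boolp.
From mathcomp Require Import freeg.

Set Implicit Arguments.
Unset Strict Implicit.
Unset Printing Implicit Defensive.

Import GRing.Theory.
Local Open Scope ring_scope.
Local Open Scope quotient_scope.

Section SubgroupQuotient.
Variables (A : zmodType) (S : A -> Prop).

(* Membership in the subgroup of A generated by S. *)
Definition spanZ (x : A) : bool :=
  `[< forall H : zmodClosed A, (forall y, S y -> y \in H) -> x \in H >].

Fact spanZ_closed : zmod_closed spanZ.
Proof.
split=> [|x y /asboolP hx /asboolP hy]; apply/asboolP => H hH; first exact: rpred0.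
by rewrite rpredB ?hx ?hy.
Qed.

HB.instance Definition _ := GRing.isZmodClosed.Build A spanZ spanZ_closed.

Definition quotZ : zmodType := Quotient.quot (GRing.ZmodClosed.clone A spanZ _).

Definition projZ (x : A) : quotZ := \pi_quotZ x.

Fact projZ_additive : zmod_morphism projZ.
Proof. by move=> x y; rewrite /projZ raddfB. Qed.

HB.instance Definition _ := GRing.isZmodMorphism.Build A quotZ projZ projZ_additive.

Lemma projZ0 y : S y -> projZ y = 0.
Proof.
move=> Sy; rewrite -(raddf0 projZ); apply/eqP.
rewrite /projZ -Quotient.idealrBE subr0 unfold_in.
by apply/asboolP => H; apply.
Qed.

Lemma projZ_ext (M : zmodType) (f g : {additive quotZ -> M}) :
  (forall x, f (projZ x) = g (projZ x)) -> forall z, f z = g z.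
Proof. by move=> fg z; rewrite -[z]reprK; apply: fg. Qed.

Section Lift.
Variables (M : zmodType) (f : {additive A -> M}).
Hypothesis fS : forall y, S y -> f y = 0.

Definition kerf (x : A) : bool := f x == 0.
Fact kerf_closed : zmod_closed kerf.
Proof.
split=> [|x y]; rewrite !unfold_in /kerf ?raddf0 // raddfB => /eqP -> /eqP ->.
by rewrite subrr.
Qed.
HB.instance Definition _ := GRing.isZmodClosed.Build A kerf kerf_closed.

Definition liftZ_fun (z : quotZ) : M := f (repr z).

Lemma liftZ_funE x : liftZ_fun (projZ x) = f x.
Proof.
have : repr (projZ x) - x \in spanZ.
  by rewrite (Quotient.idealrBE (GRing.ZmodClosed.clone A spanZ _)) reprK.
rewrite unfold_in => /asboolP /(_ (GRing.ZmodClosed.clone A kerf _)) h.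
have {h} : repr (projZ x) - x \in kerf.
  by apply: h => y /fS fy; rewrite unfold_in /kerf fy.
by rewrite unfold_in /kerf raddfB subr_eq0 => /eqP.
Qed.

Fact liftZ_additive : zmod_morphism liftZ_fun.
Proof.
move=> x y; rewrite -[x]reprK -[y]reprK -(raddfB projZ).
by rewrite !liftZ_funE raddfB.
Qed.

HB.instance Definition _ :=
  GRing.isZmodMorphism.Build quotZ M liftZ_fun liftZ_additive.

Definition liftZ : {additive quotZ -> M} := liftZ_fun.

Lemma liftZE x : liftZ (projZ x) = f x. Proof. exact: liftZ_funE. Qed.
End Lift.
End SubgroupQuotient.
(* Sealed for unification speed, here and below; use the lemmas ...E. *)
#[global] Opaque quotZ.
#[global] Opaque projZ.
#[global] Opaque liftZ.

(* {classic G} endows the bare type G with the choice structure freeg needs. *)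
Definition freeZ (G : Type) : zmodType := {freeg {classic G} / int}.
Definition genZ (G : Type) (g : G) : freeZ G := [freeg [:: (1, g : {classic G})]].

Section FreeLift.
Variables (G : Type) (M : zmodType) (f : G -> M).

Definition freelift_fun (D : freeZ G) : M := fglift (f : {classic G} -> zmodule M) D.

Fact freelift_additive : zmod_morphism freelift_fun.
Proof. exact: (lift_is_additive (f : {classic G} -> zmodule M)). Qed.

HB.instance Definition _ :=
  GRing.isZmodMorphism.Build (freeZ G) M freelift_fun freelift_additive.

Definition freelift : {additive freeZ G -> M} := freelift_fun.

Lemma freeliftE g : freelift (genZ g) = f g.
Proof. by rewrite /= /freelift_fun /genZ liftU scale1r. Qed.

Lemma freeZ_ext (h k : {additive freeZ G -> M}) :
  (forall g, h (genZ g) = k (genZ g)) -> forall z, h z = k z.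
Proof.
move=> hk z; rewrite -[z]freeg_sumE !raddf_sum; apply: eq_bigr => x _.
have -> : << coeff x z *g x >> = genZ (x : G) *~ coeff x z.
  by rewrite /genZ freegU_mulz intz.
by rewrite !raddfMz hk.
Qed.
End FreeLift.
#[global] Opaque freeZ.
#[global] Opaque genZ.
#[global] Opaque freelift.

Definition biadditive (A B M : zmodType) (f : A -> B -> M) : Prop :=
  (forall b, zmod_morphism (f^~ b)) /\ (forall a, zmod_morphism (f a)).

Section Tensor.
Variables A B : zmodType.

Inductive tensor_rel : freeZ (A * B) -> Prop :=
| tensor_rel_l a a' b :
    tensor_rel (genZ (a - a', b) - (genZ (a, b) - genZ (a', b)))
| tensor_rel_r a b b' :
    tensor_rel (genZ (a, b - b') - (genZ (a, b) - genZ (a, b'))).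

Definition tensor : zmodType := quotZ tensor_rel.

Definition tens (a : A) (b : B) : tensor := projZ tensor_rel (genZ (a, b)).

Lemma tens_biadditive : biadditive tens.
Proof.
split=> [b a a'|a b b']; apply/eqP; rewrite -subr_eq0 /tens -!raddfB /= projZ0 //.
- exact: tensor_rel_l.
- exact: tensor_rel_r.
Qed.

Lemma tensBl a a' b : tens (a - a') b = tens a b - tens a' b.
Proof. exact: tens_biadditive.1. Qed.

Lemma tensBr a b b' : tens a (b - b') = tens a b - tens a b'.
Proof. exact: tens_biadditive.2. Qed.

Lemma tensor_ext (M : zmodType) (f g : {additive tensor -> M}) :
  (forall a b, f (tens a b) = g (tens a b)) -> forall z, f z = g z.
Proof.
move=> fg; apply: projZ_ext => x.
pose p : {additive _ -> _} := projZ tensor_rel.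
by apply: (freeZ_ext (h := f \o p) (k := g \o p)) => -[a b]; apply: fg.
Qed.

Section Lift.
Variables (M : zmodType) (f : A -> B -> M).
Hypothesis f_bi : biadditive f.

Fact tensor_lift_subproof y :
  tensor_rel y -> freelift (fun ab : A * B => f ab.1 ab.2) y = 0.
Proof.
case=> [a a' b|a b b']; rewrite !raddfB !freeliftE /=.
  by have /= -> := f_bi.1 b a a'; rewrite -opprD subrr.
by have /= -> := f_bi.2 a b b'; rewrite -opprD subrr.
Qed.

Definition tensor_lift : {additive tensor -> M} := liftZ tensor_lift_subproof.

Lemma tensor_liftE a b : tensor_lift (tens a b) = f a b.
Proof. by rewrite liftZE freeliftE. Qed.
End Lift.
End Tensor.
#[global] Opaque tens.
#[global] Opaque tensor_lift.

Definition triadditive (A B C M : zmodType) (f : A -> B -> C -> M) : Prop :=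
  [/\ forall b c, zmod_morphism (fun a => f a b c),
      forall a c, zmod_morphism (fun b => f a b c)
    & forall a b, zmod_morphism (f a b)].

Section Tensor3.
Variables (A B C M : zmodType) (f : A -> B -> C -> M).
Hypothesis f_tri : triadditive f.

Fact tensor3_bi_in c : biadditive (fun a b => f a b c).
Proof. by case: f_tri => h1 h2 _; split=> [b|a]; [apply: h1 | apply: h2]. Qed.

Fact tensor3_bi_out : biadditive (fun z c => tensor_lift (tensor3_bi_in c) z).
Proof.
split=> [c|z c c']; first exact: raddfB.
pose h := tensor_lift (tensor3_bi_in c) \- tensor_lift (tensor3_bi_in c').
pose h' := tensor_lift (tensor3_bi_in (c - c')).
apply: (tensor_ext (f := h') (g := h)) => a b; rewrite /h /h' /= !tensor_liftE.
by case: f_tri => _ _ ->.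
Qed.

Definition tensor3_lift : {additive tensor (tensor A B) C -> M} :=
  tensor_lift tensor3_bi_out.

Lemma tensor3_liftE a b c : tensor3_lift (tens (tens a b) c) = f a b c.
Proof. by rewrite !tensor_liftE. Qed.

Lemma tensor3_ext (g h : {additive tensor (tensor A B) C -> M}) :
  (forall a b c, g (tens (tens a b) c) = h (tens (tens a b) c)) ->
  forall z, g z = h z.
Proof.
move=> gh; apply: tensor_ext => z c.
have add (k : {additive tensor (tensor A B) C -> M}) :
    zmod_morphism (fun z : tensor A B => k (tens z c)).
  by move=> x y; rewrite tensBl raddfB.
pose hB k := GRing.isZmodMorphism.Build (tensor A B) M _ (add k).
pose g' : {additive tensor A B -> M} := HB.pack (fun z => g (tens z c)) (hB g).
pose h' : {additive tensor A B -> M} := HB.pack (fun z => h (tens z c)) (hB h).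
by apply: (tensor_ext (f := g') (g := h')) => a b; apply: gh.
Qed.
End Tensor3.
#[global] Opaque tensor3_lift.

Section DirectSum.
Variables (I : Type) (A : I -> zmodType).

Inductive dsum_rel : freeZ {i : I & A i} -> Prop :=
| dsum_rel_add i (a a' : A i) :
    dsum_rel (genZ (existT A i (a - a'))
              - (genZ (existT A i a) - genZ (existT A i a'))).

Definition dsum : zmodType := quotZ dsum_rel.

Definition dsum_in_fun i (a : A i) : dsum := projZ dsum_rel (genZ (existT A i a)).

Fact dsum_in_additive i : zmod_morphism (@dsum_in_fun i).
Proof.
move=> a a'; apply/eqP; rewrite -subr_eq0 /dsum_in_fun -!raddfB /= projZ0 //.
Qed.

HB.instance Definition _ i :=
  GRing.isZmodMorphism.Build (A i) dsum (@dsum_in_fun i) (dsum_in_additive (i := i)).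

Definition dsum_in i : {additive A i -> dsum} := @dsum_in_fun i.

Lemma dsum_ext (M : zmodType) (f g : {additive dsum -> M}) :
  (forall i (a : A i), f (dsum_in i a) = g (dsum_in i a)) -> forall z, f z = g z.
Proof.
move=> fg; apply: projZ_ext => x.
pose p : {additive _ -> _} := projZ dsum_rel.
by apply: (freeZ_ext (h := f \o p) (k := g \o p)) => -[i a]; apply: fg.
Qed.

Section Lift.
Variables (M : zmodType) (f : forall i, {additive A i -> M}).

Fact dsum_lift_subproof y :
  dsum_rel y -> freelift (fun ia : {i : I & A i} => f (projT1 ia) (projT2 ia)) y = 0.
Proof. by case=> i a a'; rewrite !raddfB !freeliftE /= raddfB -opprD subrr. Qed.

Definition dsum_lift : {additive dsum -> M} := liftZ dsum_lift_subproof.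

Lemma dsum_liftE i a : dsum_lift (dsum_in i a) = f i a.
Proof. by rewrite liftZE freeliftE. Qed.
End Lift.
End DirectSum.
#[global] Opaque dsum_in.
#[global] Opaque dsum_lift.

Section Coequalizer.
Variables (A B : zmodType) (f g : {additive A -> B}).

Definition coeq_rel (y : B) : Prop := exists x, y = f x - g x.

Definition coeq : zmodType := quotZ coeq_rel.
Definition coeq_proj : {additive B -> coeq} := projZ coeq_rel.

Lemma coeq_projE x : coeq_proj (f x) = coeq_proj (g x).
Proof. by apply/eqP; rewrite -subr_eq0 -raddfB /= projZ0 //; exists x. Qed.

Lemma coeq_ext (M : zmodType) (h k : {additive coeq -> M}) :
  (forall y, h (coeq_proj y) = k (coeq_proj y)) -> forall z, h z = k z.
Proof. exact: projZ_ext. Qed.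

Section Lift.
Variables (M : zmodType) (h : {additive B -> M}).
Hypothesis h_eq : forall x, h (f x) = h (g x).

Fact coeq_lift_subproof y : coeq_rel y -> h y = 0.
Proof. by case=> x ->; rewrite raddfB h_eq subrr. Qed.

Definition coeq_lift : {additive coeq -> M} := liftZ coeq_lift_subproof.

Lemma coeq_liftE y : coeq_lift (coeq_proj y) = h y.
Proof. exact: liftZE. Qed.
End Lift.
End Coequalizer.
#[global] Opaque coeq_proj.
#[global] Opaque coeq_lift.

Record preadditive := Preadditive {
  obj :> Type;
  mor : obj -> obj -> zmodType;
  idm : forall X, mor X X;
  compm : forall X Y Z, mor Y Z -> mor X Y -> mor X Z;
  comp1m : forall X Y (f : mor X Y), compm (idm Y) f = f;
  compm1 : forall X Y (f : mor X Y), compm f (idm X) = f;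
  compA : forall W X Y Z (h : mor Y Z) (g : mor X Y) (f : mor W X),
    compm h (compm g f) = compm (compm h g) f;
  compDl : forall X Y Z (g g' : mor Y Z) (f : mor X Y),
    compm (g + g') f = compm g f + compm g' f;
  compDr : forall X Y Z (g : mor Y Z) (f f' : mor X Y),
    compm g (f + f') = compm g f + compm g f' }.

Arguments idm {p} X.
Arguments compm {p X Y Z} g f.
Notation "g \oc f" := (compm g f) (at level 40, left associativity).

(* The full subcategory on a family of objects.  Its objects are the indices,
   so a family indexed by a small type gives a small category. *)
Definition fullsub (A : preadditive) (I : Type) (b : I -> A) : preadditive :=
  @Preadditive I (fun i j => mor (b i) (b j)) (fun i => idm (b i))
    (fun i j k => @compm A (b i) (b j) (b k))
    (fun i j => @comp1m A (b i) (b j)) (fun i j => @compm1 A (b i) (b j))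
    (fun i j k l => @compA A (b i) (b j) (b k) (b l))
    (fun i j k => @compDl A (b i) (b j) (b k))
    (fun i j k => @compDr A (b i) (b j) (b k)).

Section CompAdditive.
Variables (A : preadditive) (X Y Z : A).

Definition precomp (f : mor X Y) (g : mor Y Z) : mor X Z := g \oc f.

Lemma compBl (g g' : mor Y Z) (f : mor X Y) :
  (g - g') \oc f = g \oc f - g' \oc f.
Proof. by apply/eqP; rewrite eq_sym subr_eq -compDl subrK. Qed.

Lemma compBr (g : mor Y Z) (f f' : mor X Y) :
  g \oc (f - f') = g \oc f - g \oc f'.
Proof. by apply/eqP; rewrite eq_sym subr_eq -compDr subrK. Qed.

Fact precomp_additive f : zmod_morphism (precomp f).
Proof. by move=> g g'; apply: compBl. Qed.

HB.instance Definition _ f :=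
  GRing.isZmodMorphism.Build (mor Y Z) (mor X Z) (precomp f) (precomp_additive f).

Fact postcomp_additive (g : mor Y Z) : zmod_morphism (@compm A X Y Z g).
Proof. by move=> f f'; apply: compBr. Qed.

HB.instance Definition _ g :=
  GRing.isZmodMorphism.Build (mor X Y) (mor X Z) (@compm A X Y Z g)
    (postcomp_additive g).

End CompAdditive.

Record presheaf (A : preadditive) := Presheaf {
  pobj :> A -> zmodType;
  pmap : forall X Y : A, mor X Y -> {additive pobj Y -> pobj X};
  pmap1 : forall X t, pmap (idm X) t = t;
  pmapM : forall X Y Z (g : mor Y Z) (f : mor X Y) t,
    pmap (g \oc f) t = pmap f (pmap g t);
  pmapD : forall X Y (f g : mor X Y) t, pmap (f + g) t = pmap f t + pmap g t }.

Arguments pmap {A} p {X Y} f.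

Lemma pmapB (A : preadditive) (F : presheaf A) (X Y : A) (f g : mor X Y) t :
  pmap F (f - g) t = pmap F f t - pmap F g t.
Proof. by apply/eqP; rewrite eq_sym subr_eq -pmapD subrK. Qed.

Record nattrans (A : preadditive) (G H : presheaf A) := Nattrans {
  ncomp :> forall X : A, {additive G X -> H X};
  natural : forall X Y (f : mor X Y) t, ncomp X (pmap G f t) = pmap H f (ncomp Y t) }.

Definition nat_iso (A : preadditive) (G H : presheaf A) (a : nattrans G H) : Prop :=
  exists b : nattrans H G,
    (forall X t, b X (a X t) = t) /\ (forall X t, a X (b X t) = t).

(* Pointwise: the zero transformation in the group of natural transformations. *)
Definition nat_zero (A : preadditive) (G H : presheaf A) (a : nattrans G H) : Prop :=
  forall X t, a X t = 0.

Record addfunctor (A A' : preadditive) := Addfunctor {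
  fobj :> A -> A';
  fmap : forall X Y : A, {additive mor X Y -> mor (fobj X) (fobj Y)};
  fmap1 : forall X, fmap X X (idm X) = idm (fobj X);
  fmapM : forall X Y Z (g : mor Y Z) (f : mor X Y),
    fmap X Z (g \oc f) = fmap Y Z g \oc fmap X Y f }.

Arguments fmap {A A'} a {X Y}.

Definition is_iso (A : preadditive) (X Y : A) (f : mor X Y) : Prop :=
  exists g : mor Y X, g \oc f = idm X /\ f \oc g = idm Y.

Definition isomorphic (A : preadditive) (X Y : A) : Prop :=
  exists f : mor X Y, is_iso f.

Definition is_zero (A : preadditive) (X : A) : Prop := idm X = 0.

(* The translation is an adjoint autoequivalence: desusp is a quasi-inverse of
   susp, with invertible counit desuspK and unit suspK.  A translation that is
   an automorphism is the case where both are identities. *)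
Record triangulated := Triangulated {
  tcat :> preadditive;
  zero_exists : exists Z : tcat, is_zero Z;
  biproduct_exists : forall X Y : tcat, exists (S : tcat)
    (i1 : mor X S) (i2 : mor Y S) (p1 : mor S X) (p2 : mor S Y),
    [/\ p1 \oc i1 = idm X, p2 \oc i2 = idm Y, p1 \oc i2 = 0, p2 \oc i1 = 0
      & i1 \oc p1 + i2 \oc p2 = idm S];

  susp : addfunctor tcat tcat;
  desusp : addfunctor tcat tcat;
  desuspK : forall X : tcat, mor (desusp (susp X)) X;
  suspK : forall X : tcat, mor X (susp (desusp X));
  desuspK_iso : forall X, is_iso (desuspK X);
  suspK_iso : forall X, is_iso (suspK X);
  desuspK_nat : forall (X Y : tcat) (f : mor X Y),
    desuspK Y \oc fmap desusp (fmap susp f) = f \oc desuspK X;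
  suspK_nat : forall (X Y : tcat) (f : mor X Y),
    suspK Y \oc f = fmap susp (fmap desusp f) \oc suspK X;
  susp_triangle : forall X, fmap susp (desuspK X) \oc suspK (susp X) = idm (susp X);
  desusp_triangle : forall X,
    desuspK (desusp X) \oc fmap desusp (suspK X) = idm (desusp X);

  (* dist u v w : the triangle K -u-> L -v-> M -w-> susp K is exact. *)
  dist : forall K L M : tcat, mor K L -> mor L M -> mor M (susp K) -> Prop;
  dist_iso : forall (K L M K' L' M' : tcat)
    (u : mor K L) (v : mor L M) (w : mor M (susp K))
    (u' : mor K' L') (v' : mor L' M') (w' : mor M' (susp K'))
    (k : mor K K') (l : mor L L') (m : mor M M'),
    is_iso k -> is_iso l -> is_iso m ->
    l \oc u = u' \oc k -> m \oc v = v' \oc l -> fmap susp k \oc w = w' \oc m ->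
    dist u v w -> dist u' v' w';
  dist_id : forall X Z : tcat, is_zero Z ->
    dist (idm X) (0 : mor X Z) (0 : mor Z (susp X));
  dist_cone : forall (K L : tcat) (u : mor K L),
    exists (M : tcat) (v : mor L M) (w : mor M (susp K)), dist u v w;
  dist_rot : forall (K L M : tcat) (u : mor K L) (v : mor L M) (w : mor M (susp K)),
    dist u v w <-> dist v w (- fmap susp u);
  dist_fill : forall (K L M K' L' M' : tcat)
    (u : mor K L) (v : mor L M) (w : mor M (susp K))
    (u' : mor K' L') (v' : mor L' M') (w' : mor M' (susp K'))
    (k : mor K K') (l : mor L L'),
    dist u v w -> dist u' v' w' -> l \oc u = u' \oc k ->
    exists m : mor M M', m \oc v = v' \oc l /\ fmap susp k \oc w = w' \oc m;
  dist_octahedron : forall (X Y Z A B C : tcat) (f : mor X Y) (g : mor Y Z)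
    (i : mor Y A) (d : mor A (susp X)) (j : mor Z C) (d' : mor C (susp Y))
    (k : mor Z B) (d'' : mor B (susp X)),
    dist f i d -> dist g j d' -> dist (g \oc f) k d'' ->
    exists (a : mor A B) (c : mor B C),
      [/\ dist a c (fmap susp i \oc d'), a \oc i = k \oc g, d'' \oc a = d,
          c \oc k = j & d' \oc c = fmap susp f \oc d''] }.

Arguments susp {t}.
Arguments desusp {t}.
Arguments desuspK {t} X.
Arguments suspK {t} X.
Arguments dist {t K L M} u v w.

Section Iterate.
Variable T : triangulated.

(* Recursing on the object makes fiter F n.+1 X convertible to
   fiter F n (F X), so that connecting maps need no cast. *)
Fixpoint fiter (F : addfunctor T T) (n : nat) (X : T) : T :=
  if n is m.+1 then fiter F m (F X) else X.

Fixpoint fiter_map (F : addfunctor T T) (n : nat) :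
    forall X Y : T, mor X Y -> mor (fiter F n X) (fiter F n Y) :=
  if n is m.+1 then fun X Y f => fiter_map F m (fmap F f) else fun X Y f => f.

(* Negz n stands for - (n + 1). *)
Definition shift (n : int) (X : T) : T :=
  match n with Posz m => fiter susp m X | Negz m => fiter desusp m.+1 X end.

Definition shift_map (n : int) (X Y : T) (f : mor X Y) :
    mor (shift n X) (shift n Y) :=
  match n with
  | Posz m => fiter_map susp m f
  | Negz m => fiter_map desusp m.+1 f
  end.

(* n + 1, by cases so that it computes. *)
Definition succz (n : int) : int :=
  match n with Posz m => Posz m.+1 | Negz 0 => Posz 0 | Negz m.+1 => Negz m end.

Lemma succzE n : succz n = n + 1.
Proof.
case: n => [m|[|m]] //=; first by rewrite -addn1 PoszD.
by rewrite !NegzE (intS m.+1) opprD addrAC addNr add0r.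
Qed.

(* The map Sigma^n M -> Sigma^(n+1) K induced by w : M -> Sigma K; in negative
   degrees the last translation cancels a desuspension. *)
Definition shift_conn (n : int) (K M : T) (w : mor M (susp K)) :
    mor (shift n M) (shift (succz n) K) :=
  match n return mor (shift n M) (shift (succz n) K) with
  | Posz m => fiter_map susp m w
  | Negz 0 => desuspK K \oc fmap desusp w
  | Negz m.+1 => fiter_map desusp m.+1 (desuspK K \oc fmap desusp w)
  end.
End Iterate.

Section Thick.
Variables (T : triangulated) (I : Type) (b : I -> T).

(* Closure of the image of b under the translation and its inverse, up to
   isomorphism since the translation is only an equivalence. *)
Definition susp_closed : Prop := forall i : I,
  (exists j, isomorphic (susp (b i)) (b j)) /\
  (exists j, isomorphic (desusp (b i)) (b j)).

Inductive thick : T -> Prop :=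
| thick_base i : thick (b i)
| thick_retract (X Y : T) (s : mor Y X) (r : mor X Y) :
    r \oc s = idm Y -> thick X -> thick Y
| thick_third (K L M : T) (u : mor K L) (v : mor L M) (w : mor M (susp K)) :
    dist u v w -> thick K -> thick L -> thick M
| thick_second (K L M : T) (u : mor K L) (v : mor L M) (w : mor M (susp K)) :
    dist u v w -> thick K -> thick M -> thick L
| thick_first (K L M : T) (u : mor K L) (v : mor L M) (w : mor M (susp K)) :
    dist u v w -> thick L -> thick M -> thick K.

Lemma thick_zero X Z : thick X -> is_zero Z -> thick Z.
Proof. by move=> tX zZ; apply: (thick_third (dist_id X zZ)). Qed.

Lemma thick_susp X : thick X -> thick (susp X).
Proof.
move=> tX; have [Z zZ] := zero_exists T.
have := dist_id X zZ; rewrite dist_rot => d.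
exact: (thick_third d tX (thick_zero tX zZ)).
Qed.

Lemma thick_desusp X : thick X -> thick (desusp X).
Proof.
move=> tX; have [Z zZ] := zero_exists T.
have := dist_id (desusp X) zZ; rewrite dist_rot => d.
apply: (thick_first d (thick_zero tX zZ)).
have [g [_ gK]] := suspK_iso X.
exact: (thick_retract gK tX).
Qed.

Lemma thick_shift n X : thick X -> thick (shift n X).
Proof.
have it (F : addfunctor T T) : (forall Y, thick Y -> thick (F Y)) ->
  forall m Y, thick Y -> thick (fiter F m Y).
  by move=> hF; elim=> //= m IH Y tY; apply/IH/hF.
case: n => m; apply: it; [exact: thick_susp | exact: thick_desusp].
Qed.

(* A record rather than {X | thick X}, to keep its universe independent of the
   one of zmodType. *)
Record thick_obj := Thick_obj { tobj :> T; tobjP : thick tobj }.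

Definition smallcat : preadditive := fullsub b.
Definition thickcat : preadditive := fullsub tobj.

Definition base_obj (i : I) : thickcat := Thick_obj (thick_base i).
Definition shift_obj (n : int) (X : thickcat) : thickcat :=
  Thick_obj (thick_shift n (tobjP X)).

Definition Upsh (G : presheaf thickcat) : presheaf smallcat :=
  @Presheaf smallcat (fun i => G (base_obj i))
    (fun i j => @pmap _ G (base_obj i) (base_obj j))
    (fun i => @pmap1 _ G (base_obj i))
    (fun i j k => @pmapM _ G (base_obj i) (base_obj j) (base_obj k))
    (fun i j => @pmapD _ G (base_obj i) (base_obj j)).

Definition Unat (G H : presheaf thickcat) (a : nattrans G H) :
    nattrans (Upsh G) (Upsh H) :=
  @Nattrans smallcat (Upsh G) (Upsh H) (fun i => a (base_obj i))
    (fun i j => @natural _ _ _ a (base_obj i) (base_obj j)).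

Definition Ypsh (X : T) : presheaf thickcat :=
  @Presheaf thickcat (fun K => mor (K : thick_obj) X)
    (fun K L (f : mor (K : thick_obj) (L : thick_obj)) => precomp f)
    (fun K t => compm1 t)
    (fun K L M g f t => compA t g f)
    (fun K L f g t => compDr t f g).

Definition Ynat (X X' : T) (f : mor X X') : nattrans (Ypsh X) (Ypsh X') :=
  @Nattrans thickcat (Ypsh X) (Ypsh X') (fun K => compm f)
    (fun K L g t => compA f t g).

Definition Fpsh (X : T) : presheaf smallcat := Upsh (Ypsh X).
Definition Fnat (X X' : T) (f : mor X X') : nattrans (Fpsh X) (Fpsh X') :=
  Unat (Ynat f).

Definition freyd_conjecture : Prop :=
  forall (X Y : thickcat) (f : mor X Y),
    nat_zero (Fnat (f : mor (X : thick_obj) (Y : thick_obj))) <-> f = 0.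

(* P_obj F K is F (x)_B C(K, -): the coequalizer of the two maps
     \sum_(i, j) F j (x) B(i, j) (x) C(K, i) -> \sum_j F j (x) C(K, j)
   sending t (x) x (x) k to F(x)(t) (x) k and to t (x) (x \oc k).  It is an
   abelian group because I, unlike the objects of T, lives in the universe of
   zmodType. *)
Section TensorOverB.
Variables (F : presheaf smallcat) (K : thickcat).

Let C_ (i : I) : zmodType := mor K (base_obj i).

Definition P_src (ij : I * I) : zmodType :=
  tensor (tensor (F ij.2) (mor (b ij.1) (b ij.2))) (C_ ij.1).
Definition P_tgt (j : I) : zmodType := tensor (F j) (C_ j).

Definition P_act (i j : I) (t : F j) (x : mor (b i) (b j)) (k : C_ i) : dsum P_tgt :=
  dsum_in P_tgt i (tens (@pmap _ F i j x t) k).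

Definition P_comp (i j : I) (t : F j) (x : mor (b i) (b j)) (k : C_ i) : dsum P_tgt :=
  dsum_in P_tgt j (tens t (x \oc k : C_ j)).

Fact P_act_triadditive (i j : I) : triadditive (@P_act i j).
Proof.
rewrite /P_act; split=> [x k t t'|t k x x'|t x k k'] /=.
- by rewrite (raddfB (pmap F x)) tensBl (raddfB (dsum_in P_tgt i)).
- by rewrite (@pmapB smallcat) tensBl (raddfB (dsum_in P_tgt i)).
- by rewrite tensBr (raddfB (dsum_in P_tgt i)).
Qed.

Fact P_comp_triadditive (i j : I) : triadditive (@P_comp i j).
Proof.
rewrite /P_comp; split=> [x k t t'|t k x x'|t x k k'].
- by rewrite tensBl (raddfB (dsum_in P_tgt j)).
- by rewrite compBl tensBr (raddfB (dsum_in P_tgt j)).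
- by rewrite compBr tensBr (raddfB (dsum_in P_tgt j)).
Qed.

Definition P_act_map : {additive dsum P_src -> dsum P_tgt} :=
  dsum_lift (fun ij : I * I => tensor3_lift (@P_act_triadditive ij.1 ij.2)).
Definition P_comp_map : {additive dsum P_src -> dsum P_tgt} :=
  dsum_lift (fun ij : I * I => tensor3_lift (@P_comp_triadditive ij.1 ij.2)).

Definition P_obj : zmodType := coeq P_act_map P_comp_map.

Definition P_tens (j : I) (t : F j) (k : C_ j) : P_obj :=
  coeq_proj P_act_map P_comp_map (dsum_in P_tgt j (tens t k)).

Lemma P_tens_biadditive (j : I) : biadditive (@P_tens j).
Proof.
by split=> [k t t'|t k k']; rewrite /P_tens ?tensBl ?tensBr !raddfB.
Qed.

Lemma P_tensBl (j : I) t t' k : @P_tens j (t - t') k = P_tens t k - P_tens t' k.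
Proof. exact: (P_tens_biadditive j).1. Qed.

Lemma P_tensBr (j : I) t k k' : @P_tens j t (k - k') = P_tens t k - P_tens t k'.
Proof. exact: (P_tens_biadditive j).2. Qed.

Lemma P_tens_balanced (i j : I) (t : F j) (x : mor (b i) (b j)) (k : C_ i) :
  P_tens (@pmap _ F i j x t) k = P_tens t (x \oc k : C_ j).
Proof.
have := coeq_projE P_act_map P_comp_map (dsum_in P_src (i, j) (tens (tens t x) k)).
by rewrite !dsum_liftE !tensor3_liftE.
Qed.

Lemma P_ext (M : zmodType) (f g : {additive P_obj -> M}) :
  (forall (j : I) t k, f (@P_tens j t k) = g (P_tens t k)) -> forall z, f z = g z.
Proof.
move=> fg; apply: coeq_ext => y.
pose p : {additive _ -> _} := coeq_proj P_act_map P_comp_map.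
apply: (dsum_ext (f := f \o p) (g := g \o p)) => j {y}.
pose q : {additive _ -> _} := p \o dsum_in P_tgt j.
by apply: (tensor_ext (f := f \o q) (g := g \o q)) => t k; apply: fg.
Qed.

Section Lift.
Variables (M : zmodType) (f : forall j : I, F j -> C_ j -> M).
Hypothesis f_bi : forall j : I, biadditive (@f j).
Hypothesis f_bal : forall (i j : I) (t : F j) (x : mor (b i) (b j)) (k : C_ i),
  f (@pmap _ F i j x t) k = f t (x \oc k : C_ j).

Let h : {additive dsum P_tgt -> M} := dsum_lift (fun j : I => tensor_lift (f_bi j)).

Fact P_lift_subproof z : h (P_act_map z) = h (P_comp_map z).
Proof.
apply: (dsum_ext (f := h \o P_act_map) (g := h \o P_comp_map)) => -[i j] {}z.
pose l (m : {additive dsum P_src -> dsum P_tgt}) : {additive _ -> _} :=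
  h \o (m \o dsum_in P_src (i, j)).
apply: (tensor3_ext (g := l P_act_map) (h := l P_comp_map)) => t x k.
rewrite /l /= !dsum_liftE !tensor3_liftE /P_act /P_comp /h !dsum_liftE.
by rewrite !tensor_liftE.
Qed.

Definition P_lift : {additive P_obj -> M} := coeq_lift P_lift_subproof.

Lemma P_liftE (j : I) t k : P_lift (@P_tens j t k) = f t k.
Proof. by rewrite coeq_liftE /h dsum_liftE tensor_liftE. Qed.
End Lift.
End TensorOverB.
#[global] Opaque P_act_map.
#[global] Opaque P_comp_map.
#[global] Opaque P_obj.
#[global] Opaque P_tens.
#[global] Opaque P_lift.

Section PMap.
Variables (F : presheaf smallcat) (K L : thickcat) (f : mor K L).

Let g (j : I) (t : F j) (k : mor L (base_obj j)) : P_obj F K := P_tens t (k \oc f).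

Fact P_map_biadditive (j : I) : biadditive (@g j).
Proof.
rewrite /g; split=> [k t t'|t k k']; first by rewrite P_tensBl.
by rewrite compBl P_tensBr.
Qed.

Fact P_map_balanced (i j : I) (t : F j) (x : mor (b i) (b j)) (k : mor L (base_obj i)) :
  g (@pmap _ F i j x t) k = g t (x \oc k : mor L (base_obj j)).
Proof.
by rewrite /g P_tens_balanced; congr P_tens; rewrite -(@compA thickcat _ _ (base_obj i)).
Qed.

Definition P_map : {additive P_obj F L -> P_obj F K} :=
  P_lift P_map_biadditive P_map_balanced.

Lemma P_mapE (j : I) t k : P_map (@P_tens F L j t k) = P_tens t (k \oc f).
Proof. exact: P_liftE. Qed.
End PMap.
#[global] Opaque P_map.

Section PPresheaf.
Variable F : presheaf smallcat.

Fact P_map1 (K : thickcat) z : P_map F (idm K) z = z.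
Proof.
apply: (P_ext (f := P_map F (idm K)) (g := idfun)) => j t k.
by rewrite P_mapE (@compm1 thickcat).
Qed.

Fact P_mapM (K L M : thickcat) (g : mor L M) (f : mor K L) z :
  P_map F (g \oc f) z = P_map F f (P_map F g z).
Proof.
apply: (P_ext (f := P_map F (g \oc f)) (g := P_map F f \o P_map F g)) => j t k /=.
by rewrite !P_mapE (@compA thickcat).
Qed.

Fact P_mapD (K L : thickcat) (f g : mor K L) z :
  P_map F (f + g) z = P_map F f z + P_map F g z.
Proof.
apply: (P_ext (f := P_map F (f + g)) (g := P_map F f \+ P_map F g)) => j t k /=.
rewrite !P_mapE (@compDr thickcat); apply/eqP.
by rewrite -subr_eq -P_tensBr addrK.
Qed.

Definition Ppsh : presheaf thickcat := Presheaf P_map1 P_mapM P_mapD.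
End PPresheaf.

Section Adjunction.
Variables (F : presheaf smallcat) (G : presheaf thickcat).

Section Transpose.
Variable a : nattrans F (Upsh G).

Section Component.
Variable K : thickcat.

Let g (j : I) (t : F j) (k : mor K (base_obj j)) : G K := pmap G k (a j t).

Fact P_transpose_biadditive (j : I) : biadditive (@g j).
Proof. by rewrite /g; split=> [k t t'|t k k']; rewrite ?pmapB ?raddfB. Qed.

Fact P_transpose_balanced (i j : I) (t : F j) (x : mor (b i) (b j))
    (k : mor K (base_obj i)) :
  g (@pmap _ F i j x t) k = g t (x \oc k : mor K (base_obj j)).
Proof.
rewrite /g (@natural _ _ _ a i j).
by rewrite -(@pmapM _ G K (base_obj i) (base_obj j)).
Qed.

Definition P_transpose_comp : {additive P_obj F K -> G K} :=
  P_lift P_transpose_biadditive P_transpose_balanced.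

Lemma P_transpose_compE (j : I) t k :
  P_transpose_comp (@P_tens F K j t k) = pmap G k (a j t).
Proof. exact: P_liftE. Qed.
End Component.

Fact P_transpose_natural (K L : thickcat) (f : mor K L) z :
  P_transpose_comp K (P_map F f z) = pmap G f (P_transpose_comp L z).
Proof.
apply: (P_ext (f := P_transpose_comp K \o P_map F f)
              (g := pmap G f \o P_transpose_comp L)) => j t k /=.
by rewrite P_mapE !P_transpose_compE pmapM.
Qed.

(* The transpose PF -> G of a : F -> UG, sending t (x) k to G(k)(a t). *)
Definition P_transpose : nattrans (Ppsh F) G :=
  @Nattrans thickcat (Ppsh F) G P_transpose_comp P_transpose_natural.
End Transpose.

Section Untranspose.
Variable c : nattrans (Ppsh F) G.

Definition P_untranspose_fun (j : I) (t : F j) : G (base_obj j) :=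
  c (base_obj j) (P_tens t (idm (base_obj j))).

Fact P_untranspose_additive (j : I) : zmod_morphism (@P_untranspose_fun j).
Proof.
move=> t t'; rewrite /P_untranspose_fun.
by rewrite P_tensBl raddfB.
Qed.

HB.instance Definition _ (j : I) :=
  GRing.isZmodMorphism.Build (F j) (G (base_obj j)) (@P_untranspose_fun j)
    (@P_untranspose_additive j).

Fact P_untranspose_natural (i j : I) (x : mor (b i) (b j)) (t : F j) :
  P_untranspose_fun (@pmap _ F i j x t)
  = @pmap _ G (base_obj i) (base_obj j) x (P_untranspose_fun t).
Proof.
rewrite /P_untranspose_fun -(natural c) /= P_mapE P_tens_balanced.
by rewrite (compm1 x) (@comp1m thickcat).
Qed.

Definition P_untranspose : nattrans F (Upsh G) :=
  @Nattrans smallcat F (Upsh G) (fun j : I => @P_untranspose_fun j)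
    P_untranspose_natural.
End Untranspose.

Lemma P_transposeK (a : nattrans F (Upsh G)) (j : I) t :
  P_untranspose (P_transpose a) j t = a j t.
Proof. by rewrite /= /P_untranspose_fun /= P_transpose_compE pmap1. Qed.

Lemma P_untransposeK (c : nattrans (Ppsh F) G) K z :
  P_transpose (P_untranspose c) K z = c K z.
Proof.
apply: (P_ext (f := P_transpose (P_untranspose c) K) (g := c K)) => j t k /=.
rewrite P_transpose_compE /= /P_untranspose_fun -(natural c) /= P_mapE.
by rewrite (@comp1m thickcat).
Qed.
End Adjunction.

(* P_transpose is a bijection Nat(PF, G) = Nat(F, UG), by the two lemmas above,
   natural by P_transpose_natl and P_transpose_natr. *)
Definition nat_id (A : preadditive) (F : presheaf A) : nattrans F F :=
  @Nattrans A F F (fun=> idfun) (fun _ _ _ _ => erefl).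

Definition nat_comp (A : preadditive) (F G H : presheaf A)
    (c : nattrans G H) (a : nattrans F G) : nattrans F H.
Proof.
apply: (@Nattrans A F H (fun X => c X \o a X)) => X Y f t /=.
by rewrite !natural.
Defined.

Definition Pnat (F F' : presheaf smallcat) (a : nattrans F F') :
    nattrans (Ppsh F) (Ppsh F') :=
  P_transpose (nat_comp (P_untranspose (nat_id (Ppsh F'))) a).

Lemma PnatE (F F' : presheaf smallcat) (a : nattrans F F') K (j : I) t k :
  Pnat a K (@P_tens F K j t k) = P_tens (a j t) k.
Proof.
rewrite /= P_transpose_compE /= /P_untranspose_fun /= P_mapE.
by rewrite (@comp1m thickcat).
Qed.

Lemma P_transpose_natl (F F' : presheaf smallcat) (G : presheaf thickcat)
    (a : nattrans F' (Upsh G)) (d : nattrans F F') K z :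
  P_transpose (nat_comp a d) K z = P_transpose a K (Pnat d K z).
Proof.
apply: (P_ext (f := P_transpose (nat_comp a d) K)
              (g := P_transpose a K \o Pnat d K)) => j t k.
transitivity (P_transpose a K (Pnat d K (P_tens t k))); last by [].
by rewrite PnatE /= !P_transpose_compE.
Qed.

Lemma P_transpose_natr (F : presheaf smallcat) (G H : presheaf thickcat)
    (a : nattrans F (Upsh G)) (c : nattrans G H) K z :
  P_transpose (nat_comp (Unat c) a) K z = c K (P_transpose a K z).
Proof.
apply: (P_ext (f := P_transpose (nat_comp (Unat c) a) K)
              (g := c K \o P_transpose a K)) => j t k /=.
by rewrite !P_transpose_compE natural.
Qed.

Definition counit (G : presheaf thickcat) : nattrans (Ppsh (Upsh G)) G :=
  P_transpose (nat_id (Upsh G)).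

Lemma counitE (G : presheaf thickcat) (K : thickcat) (j : I) t k :
  counit G K (@P_tens (Upsh G) K j t k) = pmap G k t.
Proof. exact: P_transpose_compE. Qed.

Definition exact_at (A B C : zmodType) (f : A -> B) (g : B -> C) : Prop :=
  forall y, g y = 0 <-> exists x, f x = y.

Section LongSequence.
Variables (G : presheaf thickcat) (K L M : thickcat).
Variables (u : mor (tobj K) (tobj L)) (v : mor (tobj L) (tobj M)).
Variable w : mor (tobj M) (susp (tobj K)).

Definition seq_u (n : int) : {additive G (shift_obj n L) -> G (shift_obj n K)} :=
  @pmap _ G (shift_obj n K) (shift_obj n L) (shift_map n u).
Definition seq_v (n : int) : {additive G (shift_obj n M) -> G (shift_obj n L)} :=
  @pmap _ G (shift_obj n L) (shift_obj n M) (shift_map n v).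
Definition seq_w (n : int) :
    {additive G (shift_obj (succz n) K) -> G (shift_obj n M)} :=
  @pmap _ G (shift_obj n M) (shift_obj (succz n) K) (shift_conn n w).

(* Exactness at G(Sigma^n L), G(Sigma^n M) and G(Sigma^(n+1) K), for all n. *)
Definition long_exact : Prop := forall n : int,
  [/\ exact_at (seq_v n) (seq_u n), exact_at (seq_w n) (seq_v n)
    & exact_at (seq_u (succz n)) (seq_w n)].
End LongSequence.
End Thick.

(* Main.v *)
From HB Require Import structures.
From mathcomp Require Import all_boot all_order all_algebra.
From mathcomp Require Import boolp.
Require Import Defs.

Set Implicit Arguments.
Unset Strict Implicit.
Unset Printing Implicit Defensive.

Import GRing.Theory.
Local Open Scope ring_scope.

(** Both sides of the counit at X, namely PFX and YX, turn exact triangles into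
long exact sequences: PFX by hypothesis, YX because representable functors are
cohomological. On an object of B the counit is invertible, since over B the
tensor product with a representable functor is evaluation. The objects at which
the counit is bijective in all degrees of translation are closed under retracts
and, by the five lemma, satisfy two out of three in exact triangles, so they are
all of C. All degrees have to be treated together because the five lemma at one
vertex of a triangle involves translates of the other two; this is where the
closure of B under the translation enters, as it provides the base case
[counit_base_bij] in every degree. The induction is [shift_bij_thick].

For the long exact sequence of YX, exactness at one term says that a map of a
triangle is a weak cokernel of the preceding one ([weak_coker]). It is enough to
know this for the triangle itself, where it follows from the completion axiom,
and to carry it to the other degrees. The translation and its quasi-inverse are
left adjoints of each other, and additive left adjoints preserve weak cokernels
([left_adjoint_weak_coker]); this avoids the signs of translated triangles.

For the Freyd conjecture, let Ff = 0 with f : X -> Y. By naturality f kills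
the image of the counit at X ([Fnat_zero_counit]); that image contains the
identity of X, so f = 0. *)

(** * Five lemma *)

(** Injectivity and surjectivity without a chosen inverse: this is the form
in which the five lemma consumes and produces bijectivity. *)
Definition bij (A B : Type) (f : A -> B) : Prop :=
  injective f /\ forall y, exists x, f x = y.

Section FiveLemma.
Variables (A1 A2 A3 A4 A5 B1 B2 B3 B4 B5 : zmodType).
Variables (f1 : {additive A1 -> A2}) (f2 : {additive A2 -> A3}).
Variables (f3 : {additive A3 -> A4}) (f4 : {additive A4 -> A5}).
Variables (g1 : {additive B1 -> B2}) (g2 : {additive B2 -> B3}).
Variables (g3 : {additive B3 -> B4}) (g4 : {additive B4 -> B5}).
Variables (a1 : {additive A1 -> B1}) (a2 : {additive A2 -> B2}).
Variables (a3 : {additive A3 -> B3}) (a4 : {additive A4 -> B4}).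
Variable a5 : {additive A5 -> B5}.

Lemma five_lemma :
  exact_at f1 f2 -> exact_at f2 f3 -> exact_at f3 f4 ->
  exact_at g1 g2 -> exact_at g2 g3 -> exact_at g3 g4 ->
  (forall x, a2 (f1 x) = g1 (a1 x)) -> (forall x, a3 (f2 x) = g2 (a2 x)) ->
  (forall x, a4 (f3 x) = g3 (a3 x)) -> (forall x, a5 (f4 x) = g4 (a4 x)) ->
  bij a1 -> bij a2 -> bij a4 -> bij a5 -> bij a3.
Proof.
move=> ef12 ef23 ef34 eg12 eg23 eg34 s1 s2 s3 s4.
move=> [_ a1s] [a2i a2s] [a4i a4s] [a5i _]; split.
  apply: raddf_inj => x a3x0.
  have /ef23[y fy] : f3 x = 0 by apply: a4i; rewrite s3 a3x0 !raddf0.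
  have /eg12[z gz] : g2 (a2 y) = 0 by rewrite -s2 fy.
  have [z' a1z'] := a1s z.
  have f1z' : f1 z' = y by apply: a2i; rewrite s1 a1z'.
  by rewrite -fy; apply/ef12; exists z'.
move=> y; have [x4 a4x4] := a4s (g3 y).
have /ef34[x f3x] : f4 x4 = 0.
  by apply: a5i; rewrite s4 a4x4 raddf0; apply/eg34; exists y.
have /eg23[y2 g2y2] : g3 (y - a3 x) = 0 by rewrite raddfB -s3 f3x a4x4 subrr.
have [x2 a2x2] := a2s y2.
by exists (x + f2 x2); rewrite raddfD s2 a2x2 g2y2 addrC subrK.
Qed.
End FiveLemma.

(** * Weak cokernels *)

Section WeakCokernel.
Variable A : preadditive.

Lemma compm0 (X Y Z : A) (g : mor Y Z) : g \oc (0 : mor X Y) = 0.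
Proof. exact: raddf0. Qed.

Lemma comp0m (X Y Z : A) (f : mor X Y) : (0 : mor Y Z) \oc f = 0.
Proof. exact: (raddf0 (@precomp A X Y Z f)). Qed.

Lemma compNm (X Y Z : A) (g : mor Y Z) (f : mor X Y) : (- g) \oc f = - (g \oc f).
Proof. exact: (raddfN (@precomp A X Y Z f)). Qed.

Lemma is_iso_id (X : A) : is_iso (idm X).
Proof. by exists (idm X); rewrite comp1m. Qed.

Definition weak_coker (K L M : A) (u : mor K L) (v : mor L M) : Prop :=
  forall (X : A) (g : mor L X), g \oc u = 0 <-> exists h, h \oc v = g.

Lemma weak_coker_iso (K L M K' L' M' : A) (u : mor K L) (v : mor L M)
    (u' : mor K' L') (v' : mor L' M') (k : mor K K') (l : mor L L') (m : mor M M') :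
  is_iso k -> is_iso l -> is_iso m -> l \oc u = u' \oc k -> m \oc v = v' \oc l ->
  weak_coker u v -> weak_coker u' v'.
Proof.
move=> [k' [_ kk']] [l' [l'l ll']] [m' [m'm _]] sq1 sq2 wc X g; split=> [gu'|[h <-]].
  have /wc[h hv] : (g \oc l) \oc u = 0 by rewrite -compA sq1 compA gu' comp0m.
  exists (h \oc m'); rewrite -[v']compm1 -ll' [v' \oc _]compA -sq2.
  by rewrite -!compA [m' \oc (m \oc _)]compA m'm comp1m compA hv -compA ll' compm1.
have vu : v \oc u = 0 by apply/wc; exists (idm M); rewrite comp1m.
rewrite -compA -[u']compm1 -kk' [u' \oc _]compA -sq1 [v' \oc _]compA.
by rewrite [v' \oc _]compA -sq2 -[_ \oc v \oc u]compA vu compm0 comp0m compm0.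
Qed.

Lemma weak_cokerN (K L M : A) (u : mor K L) (v : mor L M) :
  weak_coker u v -> weak_coker u (- v).
Proof.
have NN : (- idm M) \oc (- idm M) = idm M.
  by rewrite compNm comp1m opprK.
have isoN : is_iso (- idm M) by exists (- idm M).
apply: (weak_coker_iso (is_iso_id K) (is_iso_id L) isoN).
  by rewrite comp1m compm1.
by rewrite compm1 compNm comp1m.
Qed.

(** The hypothesis is the part of an adjunction F -| G that the proof uses: e is
the counit at X and g' the adjunct of g, which by naturality kills u as soon as
g kills F u. Stated so, units and counits that are only known to exist as
inverses need not be chosen. *)
Lemma left_adjoint_weak_coker (F G : addfunctor A A) :
  (forall (L X : A) (g : mor (F L) X), exists (g' : mor L (G X)) (e : mor (F (G X)) X),
     e \oc fmap F g' = g /\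
     forall K (u : mor K L), g \oc fmap F u = 0 -> g' \oc u = 0) ->
  forall (K L M : A) (u : mor K L) (v : mor L M),
  weak_coker u v -> weak_coker (fmap F u) (fmap F v).
Proof.
move=> adj K L M u v wc X g; split=> [gFu|[h <-]].
  have [g' [e [ge /(_ K u gFu)/wc[h hv]]]] := adj L X g; rewrite -ge -hv.
  by exists (e \oc fmap F h); rewrite fmapM compA.
have vu : v \oc u = 0 by apply/wc; exists (idm M); rewrite comp1m.
by rewrite -compA -fmapM vu raddf0 compm0.
Qed.

End WeakCokernel.

(** * Exact triangles *)

Section Triangles.
Variable T : triangulated.

(** Completion of morphisms of triangles, once into the triangle 0 -> X = X -> 0
to extend g along v, and once out of K = K -> 0 -> susp K to see that v u = 0. *)
Lemma dist_weak_coker (K L M : T) (u : mor K L) (v : mor L M) (w : mor M (susp K)) :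
  dist u v w -> weak_coker u v.
Proof.
move=> d X g; have [Z zZ] := zero_exists T; split=> [gu|[h <-]].
  have zSZ : is_zero (susp Z) by rewrite /is_zero -fmap1 zZ raddf0.
  have dX : dist (0 : mor Z X) (idm X) (0 : mor X (susp Z)).
    by apply/dist_rot; rewrite raddf0 oppr0; apply: dist_id.
  have [|h [hv _]] := dist_fill (k := 0 : mor K Z) (l := g) d dX.
    by rewrite gu comp0m.
  by exists h; rewrite hv comp1m.
have [|m [mv _]] := dist_fill (k := idm K) (l := u) (dist_id K zZ) d; first by [].
by rewrite -compA -mv !compm0.
Qed.

(** The translation is left adjoint to its quasi-inverse, with unit the inverse
of [desuspK] and counit the inverse of [suspK]. *)
Lemma susp_weak_coker (K L M : T) (u : mor K L) (v : mor L M) :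
  weak_coker u v -> weak_coker (fmap susp u) (fmap susp v).
Proof.
move: K L M u v; apply: (@left_adjoint_weak_coker _ susp desusp) => L X g.
have [e [eK _]] := suspK_iso X; have [d [dK Kd]] := desuspK_iso L.
exists (fmap desusp g \oc d), e; split.
  (* Both sides invert fmap susp (desuspK L), by the triangle identity. *)
  have Sd : fmap susp d = suspK (susp L).
    rewrite -[LHS]compm1 -susp_triangle compA -fmapM dK.
    by rewrite fmap1 comp1m.
  by rewrite fmapM Sd -suspK_nat compA eK comp1m.
move=> K u gu; have [d' [d'K Kd']] := desuspK_iso K.
have du : d \oc u = fmap desusp (fmap susp u) \oc d'.
  rewrite -[d \oc u]compm1 -Kd' -compA [u \oc _]compA -desuspK_nat.
  by rewrite !compA dK comp1m.
by rewrite -compA du compA -fmapM gu raddf0 comp0m.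
Qed.

(** Here the unit is [suspK] and the counit [desuspK]. *)
Lemma desusp_weak_coker (K L M : T) (u : mor K L) (v : mor L M) :
  weak_coker u v -> weak_coker (fmap desusp u) (fmap desusp v).
Proof.
move: K L M u v; apply: (@left_adjoint_weak_coker _ desusp susp) => L X g.
exists (fmap susp g \oc suspK L), (desuspK X); split=> [|K u gu].
  by rewrite fmapM compA desuspK_nat -compA desusp_triangle compm1.
by rewrite -compA suspK_nat compA -fmapM gu raddf0 comp0m.
Qed.

Lemma fiter_weak_coker (F : addfunctor T T) :
  (forall (K L M : T) (u : mor K L) (v : mor L M),
    weak_coker u v -> weak_coker (fmap F u) (fmap F v)) ->
  forall m (K L M : T) (u : mor K L) (v : mor L M),
  weak_coker u v -> weak_coker (fiter_map F m u) (fiter_map F m v).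
Proof. by move=> hF; elim=> //= m IH K L M u v /hF/IH. Qed.

(** In negative degrees the connecting map is [desuspK K \oc fmap desusp w], so
the desuspended pairs are first moved along [desuspK] and then iterated. *)
Lemma shift_weak_coker (K L M : T) (u : mor K L) (v : mor L M) (w : mor M (susp K))
    (n : int) : dist u v w ->
  [/\ weak_coker (shift_map n u) (shift_map n v),
      weak_coker (shift_map n v) (shift_conn n w)
    & weak_coker (shift_conn n w) (shift_map (succz n) u)].
Proof.
move=> d; have dvw := iffLR (dist_rot _ _ _) d.
have uv := dist_weak_coker d; have vw := dist_weak_coker dvw.
have wu : weak_coker w (fmap susp u).
  rewrite -[fmap susp u]opprK; apply: weak_cokerN.
  exact: dist_weak_coker (iffLR (dist_rot _ _ _) dvw).
case: n => m.
  by split; apply: (@fiter_weak_coker susp susp_weak_coker m).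
have Duv := desusp_weak_coker uv.
have Dvw : weak_coker (fmap desusp v) (desuspK K \oc fmap desusp w).
  apply: weak_coker_iso (is_iso_id _) (is_iso_id _) (desuspK_iso K) _ _
    (desusp_weak_coker vw); first by rewrite comp1m compm1.
  by rewrite compm1.
have Dwu : weak_coker (desuspK K \oc fmap desusp w) u.
  apply: weak_coker_iso (is_iso_id _) (desuspK_iso K) (desuspK_iso L) _ _
    (desusp_weak_coker wu); first by rewrite compm1.
  by rewrite desuspK_nat.
case: m => [|m]; first by split.
by split; apply: (@fiter_weak_coker desusp desusp_weak_coker m.+1).
Qed.

(** * Retracts *)

Definition retract (Y X : T) : Prop :=
  exists (s : mor Y X) (r : mor X Y), r \oc s = idm Y.

Lemma retract_refl (X : T) : retract X X.
Proof. by exists (idm X), (idm X); rewrite comp1m. Qed.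

Lemma retract_trans (X Y Z : T) : retract X Y -> retract Y Z -> retract X Z.
Proof.
move=> [s [r rs]] [s' [r' rs']]; exists (s' \oc s), (r \oc r').
by rewrite -compA [r' \oc _]compA rs' comp1m.
Qed.

Lemma isomorphic_retract (X Y : T) : isomorphic X Y -> retract X Y.
Proof. by move=> [f [g [gf _]]]; exists f, g. Qed.

Lemma fiter_retract (F : addfunctor T T) m (X Y : T) :
  retract X Y -> retract (fiter F m X) (fiter F m Y).
Proof.
elim: m X Y => //= m IH X Y [s [r rs]]; apply: IH.
by exists (fmap F s), (fmap F r); rewrite -fmapM rs fmap1.
Qed.

Lemma shift_retract n (X Y : T) : retract X Y -> retract (shift n X) (shift n Y).
Proof. by case: n => m; apply: fiter_retract. Qed.

End Triangles.

(** * Comparison of presheaves on the thick subcategory *)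

Section Counit.
Variables (T : triangulated) (I : Type) (b : I -> T).

Lemma shift_base_retract : susp_closed b ->
  forall n i, exists j, retract (shift n (b i)) (b j).
Proof.
move=> cl n i.
have it (F : addfunctor T T) : (forall i, exists j, isomorphic (F (b i)) (b j)) ->
    forall m i, exists j, retract (fiter F m (b i)) (b j).
  move=> hF; elim=> [|m IH] {}i /=.
    by exists i; apply: retract_refl.
  have [j /isomorphic_retract Fij] := hF i; have [k jk] := IH j.
  by exists k; apply: retract_trans jk; apply: fiter_retract.
by case: n => m; apply: it => {}i; have [? ?] := cl i.
Qed.

Lemma Ypsh_long_exact (X : T) (K L M : thickcat b) (u : mor (tobj K) (tobj L))
    (v : mor (tobj L) (tobj M)) (w : mor (tobj M) (susp (tobj K))) :
  dist u v w -> long_exact (Ypsh b X) u v w.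
Proof.
by move=> d n; have [h1 h2 h3] := shift_weak_coker n d; split=> g;
  [apply: h1 | apply: h2 | apply: h3].
Qed.

(** Applied also to identities, this makes bijectivity independent of the proof
of thickness carried by an object of [thickcat b]. *)
Lemma bij_retract (G H : presheaf (thickcat b)) (a : nattrans G H)
    (K L : thickcat b) : retract (tobj K) (tobj L) -> bij (a L) -> bij (a K).
Proof.
move=> [s [r rs]] [ai asurj].
pose s' : mor K L := s; pose r' : mor L K := r.
have rs' (E : presheaf (thickcat b)) t : pmap E s' (pmap E r' t) = t.
  by rewrite -pmapM (_ : r' \oc s' = idm K) ?pmap1.
split=> [x y axy|y].
  suff xy : pmap G r' x = pmap G r' y by rewrite -[x]rs' xy rs'.
  by apply: ai; rewrite !natural axy.
have [x ax] := asurj (pmap H r' y).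
by exists (pmap G s' x); rewrite natural ax rs'.
Qed.

(** The inverse sends t to t (x) 1, because balancing over B gives
t (x) k = G(k)(t) (x) 1 when k is a map of B. *)
Lemma counit_base_bij (G : presheaf (thickcat b)) (i : I) :
  bij (counit G (base_obj b i)).
Proof.
pose eta := P_untranspose (nat_id (Ppsh (Upsh G))) i.
have epsK t : counit G (base_obj b i) (eta t) = t.
  by rewrite /eta /= /P_untranspose_fun counitE pmap1.
have etaK z : eta (counit G (base_obj b i) z) = z.
  apply: (P_ext (f := eta \o counit G (base_obj b i)) (g := idfun)) => j t k.
  transitivity (eta (counit G (base_obj b i) (P_tens t k))); first by [].
  rewrite counitE /eta /= /P_untranspose_fun /=.
  rewrite (@P_tens_balanced _ _ _ (Upsh G) (base_obj b i) i j t k).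
  by congr P_tens; apply: compm1.
by split=> [|t]; [apply: can_inj etaK | exists (eta t)].
Qed.

Definition shift_bij (G H : presheaf (thickcat b)) (a : nattrans G H)
  (K : thickcat b) : Prop := forall n, bij (a (shift_obj n K)).

Section TwoOutOfThree.
Variables (G H : presheaf (thickcat b)) (a : nattrans G H).
Variables (K L M : thickcat b) (u : mor (tobj K) (tobj L)).
Variables (v : mor (tobj L) (tobj M)) (w : mor (tobj M) (susp (tobj K))).
Hypotheses (exG : long_exact G u v w) (exH : long_exact H u v w).

Lemma succz_surj n : exists m, n = succz m.
Proof. by exists (n - 1); rewrite succzE subrK. Qed.

Let sq_u n x : a _ (seq_u G u n x) = seq_u H u n (a _ x). Proof. exact: natural. Qed.
Let sq_v n x : a _ (seq_v G v n x) = seq_v H v n (a _ x). Proof. exact: natural. Qed.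
Let sq_w n x : a _ (seq_w G w n x) = seq_w H w n (a _ x). Proof. exact: natural. Qed.

(** The five consecutive terms centred at the missing vertex, in degree n for M.
For L and K the window reaches into the preceding degree, so n is written as a
value of [succz], which keeps the types of the connecting maps free of casts. *)
Lemma shift_bij_third : shift_bij a K -> shift_bij a L -> shift_bij a M.
Proof.
move=> bK bL n; have [G1 G2 G3] := exG n; have [H1 H2 H3] := exH n.
exact: (five_lemma G3 G2 G1 H3 H2 H1 (@sq_u _) (@sq_w _) (@sq_v _) (@sq_u _)).
Qed.

Lemma shift_bij_second : shift_bij a K -> shift_bij a M -> shift_bij a L.
Proof.
move=> bK bM n; have [m ->] := succz_surj n.
have [G1 G2 _] := exG (succz m); have [H1 H2 _] := exH (succz m).
have [_ _ G3] := exG m; have [_ _ H3] := exH m.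
exact: (five_lemma G2 G1 G3 H2 H1 H3 (@sq_w _) (@sq_v _) (@sq_u _) (@sq_w _)).
Qed.

Lemma shift_bij_first : shift_bij a L -> shift_bij a M -> shift_bij a K.
Proof.
move=> bL bM n; have [m ->] := succz_surj n.
have [G1 _ _] := exG (succz m); have [H1 _ _] := exH (succz m).
have [_ G2 G3] := exG m; have [_ H2 H3] := exH m.
exact: (five_lemma G1 G3 G2 H1 H3 H2 (@sq_v _) (@sq_u _) (@sq_w _) (@sq_v _)).
Qed.
End TwoOutOfThree.

Lemma shift_bij_thick (G H : presheaf (thickcat b)) (a : nattrans G H) :
  (forall i, shift_bij a (base_obj b i)) ->
  (forall (K L M : thickcat b) (u : mor (tobj K) (tobj L))
      (v : mor (tobj L) (tobj M)) (w : mor (tobj M) (susp (tobj K))),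
    dist u v w -> long_exact G u v w /\ long_exact H u v w) ->
  forall K, shift_bij a K.
Proof.
move=> base ex [K tK].
(* The induction is on one proof of thickness, the claim about all of them. *)
suff: forall tK' : thick b K, shift_bij a (Thick_obj tK') by apply.
elim: tK => {K}.
- by move=> i t n; apply: bij_retract (base i n); apply: retract_refl.
- move=> X Y s r rs tX IH tY n; apply: bij_retract (IH tX n).
  by apply: shift_retract; exists s, r.
- move=> K L M u v w d tK IHK tL IHL tM.
  have [exG exH] := ex (Thick_obj tK) (Thick_obj tL) (Thick_obj tM) u v w d.
  exact: shift_bij_third exG exH (IHK tK) (IHL tL).
- move=> K L M u v w d tK IHK tM IHM tL.
  have [exG exH] := ex (Thick_obj tK) (Thick_obj tL) (Thick_obj tM) u v w d.
  exact: shift_bij_second exG exH (IHK tK) (IHM tM).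
- move=> K L M u v w d tL IHL tM IHM tK.
  have [exG exH] := ex (Thick_obj tK) (Thick_obj tL) (Thick_obj tM) u v w d.
  exact: shift_bij_first exG exH (IHL tL) (IHM tM).
Qed.

End Counit.

(** * Isomorphism and faithfulness *)

Lemma bij_nat_iso (A : preadditive) (G H : presheaf A) (a : nattrans G H) :
  (forall X, bij (a X)) -> nat_iso a.
Proof.
move=> abij.
have inv X : exists g : {additive H X -> G X},
    (forall t, g (a X t) = t) /\ (forall t, a X (g t) = t).
  have [ai /boolp.choice[g ag]] := abij X.
  have g_add : zmod_morphism g by move=> x y; apply: ai; rewrite raddfB !ag.
  pose hB := GRing.isZmodMorphism.Build (H X) (G X) g g_add.
  pose g' : {additive H X -> G X} := HB.pack g hB.
  by exists g'; split=> t //; apply: ai; rewrite ag.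
pose g X := projT1 (cid (inv X)); have gP X := projT2 (cid (inv X)).
have g_nat X Y (f : mor X Y) t : g X (pmap H f t) = pmap G f (g Y t).
  by apply: (abij X).1; rewrite natural (gP X).2 (gP Y).2.
by exists (Nattrans g_nat); split=> X t; have [? ?] := gP X.
Qed.

(** On a generator t (x) k the counit is t k with t a map out of an object of B,
and f t = Ff(t) = 0. *)
Lemma Fnat_zero_counit (T : triangulated) (I : Type) (b : I -> T) (X Y : T)
    (f : mor X Y) : nat_zero (Fnat b f) ->
  forall (K : thickcat b) z, f \oc (counit (Ypsh b X) K z) = 0.
Proof.
move=> f0 K z; pose f' : {additive mor (tobj K) X -> mor (tobj K) Y} := compm f.
apply: (P_ext (f := f' \o counit (Ypsh b X) K) (g := \0)) => j t k.
transitivity (f' (counit (Ypsh b X) K (P_tens t k))); first by [].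
rewrite counitE /f' /= /precomp compA.
by have /= -> := f0 j t; apply: comp0m.
Qed.

Theorem proposition3 (T : triangulated) (I : Type) (b : I -> T)
  (b_inj : injective b) (b_susp : susp_closed b)
  (exactPF : forall (K L M : thickcat b) (u : mor (tobj K) (tobj L))
      (v : mor (tobj L) (tobj M)) (w : mor (tobj M) (susp (tobj K))),
    dist u v w ->
    forall X : thickcat b, long_exact (Ppsh (Fpsh b (tobj X))) u v w) :
  (forall X : thickcat b, nat_iso (counit (Ypsh b (tobj X)))) /\
  freyd_conjecture b.
Proof.
have eps_bij (X K : thickcat b) : bij (counit (Ypsh b (tobj X)) K).
  suff bijK : shift_bij (counit (Ypsh b (tobj X))) K.
    by apply: bij_retract (bijK (Posz 0)); apply: retract_refl.
  apply: shift_bij_thick => [i n|K' L M u v w d].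
    have [j ij] := shift_base_retract b_susp n i.
    exact: (bij_retract (L := base_obj b j)) (counit_base_bij _ j).
  by split; [apply: exactPF | apply: Ypsh_long_exact].
split=> [X|X Y f]; first exact: bij_nat_iso (eps_bij X).
split=> [f0|-> i t]; last exact: comp0m.
have [z zE] := (eps_bij X X).2 (idm (tobj X)).
by rewrite -[f](@compm1 T) -zE; apply: Fnat_zero_counit.
Qed.
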